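(* Let $S$ and $T$ be zerosumfree congruence-semisimple semirings. Then $(SK_0(S), \widehat{S}) \cong (SK_0(T), \widehat{T})$ (i.e. there is a group isomorphism $f\colon SK_0(S)\to SK_0(T)$ with $f(\widehat{S})=\widehat{T}$ and $f(SK_0(S)^+)=SK_0(T)^+$) if and only if $S \cong T$ as $\mathbb{B}$-algebras.
   Context: A semiring $(S,+,\cdot,0,1)$ consists of a commutative monoid $(S,+,0)$ and a monoid $(S,\cdot,1)$ such that multiplication distributes over addition on both sides and $0s=0=s0$. It is zerosumfree if $a+b=0$ implies $a=b=0$. Right $S$-semimodules are commutative monoids with a unital, biadditive, associative right action of $S$ with $0_Ms=0_M=m0$. A nonzero semimodule $M$ is congruence-simple if its only congruences (equivalence relations compatible with addition and scalar multiplication) are the identity congruence and $M\times M$. A semiring $S$ is congruence-semisimple if it is a direct sum of right ideals each of which is congruence-simple as a right $S$-semimodule (equivalently, the same with left ideals). The Boolean semifield is $\mathbb{B}=(\{0,1\},\max,\min,0,1)$; every additively idempotent semiring (i.e. $s+s=s$ for all $s$) is canonically a $\mathbb{B}$-algebra, and zerosumfree congruence-semisimple semirings are additively idempotent. A finitely generated strongly projective right $S$-semimodule is one isomorphic to a direct summand of $S^n$ for some $n$. $SK_0(S)$ is the Grothendieck group of the commutative monoid of isomorphism classes of finitely generated strongly projective right $S$-semimodules under direct sum; $\widehat{P}$ denotes the class of $P$ in $SK_0(S)$. It is a pre-ordered abelian group with cone $SK_0(S)^+=\{\widehat{P}\mid P \text{ finitely generated strongly projective}\}$, with order-unit $\widehat{S}$.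 *)

(* Defs.v *)
From HB Require Import structures.
From mathcomp Require Import all_boot all_order all_algebra.
From mathcomp Require Import boolp classical_sets functions cardinality fsbigop.

Set Implicit Arguments.
Unset Strict Implicit.
Unset Printing Implicit Defensive.

Import GRing.Theory.

Local Open Scope quotient_scope.
Local Open Scope classical_set_scope.
Local Open Scope ring_scope.

(* Semirings are [pzSemiRingType]s: the equality 0 = 1 is not excluded.       *)
(* A right S-semimodule is an [lSemiModType S^c], with S^c the converse       *)
(* semiring: the right action m . s is [(s : S^c) *: m].  The generic notions *)
(* below are stated for [lSemiModType R] and used at R := S^c.                *)

Definition zerosumfree (S : pzSemiRingType) : Prop :=
  forall a b : S, a + b = 0 -> a = 0 /\ b = 0.

Section Semimodules.
Variable R : pzSemiRingType.
Implicit Types M N : lSemiModType R.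

Record congruence M (r : M -> M -> Prop) : Prop := Congruence {
  congr_refl : forall x, r x x;
  congr_sym : forall x y, r x y -> r y x;
  congr_trans : forall x y z, r x y -> r y z -> r x z;
  congr_add : forall x y x' y', r x y -> r x' y' -> r (x + x') (y + y');
  congr_scale : forall a x y, r x y -> r (a *: x) (a *: y)
}.

Definition congruence_simple M : Prop :=
  (exists x : M, x != 0) /\
  forall r : M -> M -> Prop, congruence r ->
    (forall x y, r x y <-> x = y) \/ (forall x y, r x y).

Definition semimod_iso M N : Prop :=
  exists f : {linear M -> N}, bijective f.

Definition subsemimod M (P : submodClosed M) : Type := {x : M | x \in P}.

HB.instance Definition _ M (P : submodClosed M) :=
  SubChoice.on (subsemimod P).
HB.instance Definition _ M (P : submodClosed M) :=
  [SubChoice_isSubLSemiModule of subsemimod P by <:].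

(* Internal direct sums. *)
Definition direct_sum M (I : choiceType) (J : I -> submodClosed M) : Prop :=
  forall v : M, exists! x : I -> M,
    [/\ forall i, x i \in J i,
        finite_set [set i | x i != 0] &
        v = \sum_(i \in [set: I]) x i].

Definition direct_sum2 M (P Q : submodClosed M) : Prop :=
  forall v : M, exists! x : M * M,
    [/\ x.1 \in P, x.2 \in Q & v = x.1 + x.2].

Definition direct_summand M (P : submodClosed M) : Prop :=
  exists Q : submodClosed M, direct_sum2 P Q.

Record free_summand : Type := FreeSummand {
  fs_rank : nat;
  fs_pred : submodClosed 'rV[R]_fs_rank;
  fs_summand : direct_summand fs_pred
}.

Definition fs_semimod (D : free_summand) : lSemiModType R :=
  subsemimod (fs_pred D).

Definition fg_strongly_projective M : Prop :=
  exists D : free_summand, semimod_iso M (fs_semimod D).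

Lemma semimod_iso_refl M : semimod_iso M M.
Proof. by exists idfun; exists idfun. Qed.

Lemma semimod_iso_sym M N : semimod_iso M N -> semimod_iso N M.
Proof.
case=> f [g fK gK].
have gl : GRing.semilinear_for *:%R g.
  split=> [a x|x y]; apply: (can_inj fK).
    by rewrite linearZ !gK.
  by rewrite raddfD /= !gK.
pose G : {linear N -> M} :=
  HB.pack g (GRing.isSemilinear.Build _ _ _ _ g gl).
by exists G; exists f.
Qed.

Lemma semimod_iso_trans M N (L : lSemiModType R) :
  semimod_iso M N -> semimod_iso N L -> semimod_iso M L.
Proof. by case=> f bf [g bg]; exists (g \o f); apply: bij_comp. Qed.

Lemma semimod_iso_prod M N (M' N' : lSemiModType R) :
  semimod_iso M M' -> semimod_iso N N' ->
  semimod_iso (M * N)%type (M' * N')%type.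
Proof.
case=> f [f' fK f'K] [g [g' gK g'K]].
pose h (x : M * N) : M' * N' := (f x.1, g x.2).
have hl : GRing.semilinear_for *:%R h.
  by split=> [a x|x y]; rewrite /h /= ?linearZ ?raddfD.
exists (HB.pack_for {linear _ -> _} h (GRing.isSemilinear.Build _ _ _ _ h hl)).
exists (fun x => (f' x.1, g' x.2)) => -[x y] /=; first by rewrite fK gK.
by rewrite /h /= f'K g'K.
Qed.

Lemma semimod_iso_prodC M N : semimod_iso (M * N)%type (N * M)%type.
Proof.
pose h (x : M * N) : N * M := (x.2, x.1).
have hl : GRing.semilinear_for *:%R h by [].
exists (HB.pack_for {linear _ -> _} h (GRing.isSemilinear.Build _ _ _ _ h hl)).
by exists (fun x => (x.2, x.1)) => -[].
Qed.

Lemma semimod_iso_prodA M N (L : lSemiModType R) :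
  semimod_iso (M * (N * L))%type ((M * N) * L)%type.
Proof.
pose h (x : M * (N * L)) : M * N * L := (x.1, x.2.1, x.2.2).
have hl : GRing.semilinear_for *:%R h by [].
exists (HB.pack_for {linear _ -> _} h (GRing.isSemilinear.Build _ _ _ _ h hl)).
by exists (fun x => (x.1.1, (x.1.2, x.2))) => [[? []] | [[]]].
Qed.

End Semimodules.

(* Right ideals of S are subsemimodules of the right semimodule S, which is   *)
(* the regular semimodule of S^c.                                             *)
Definition right_regular (S : pzSemiRingType) : lSemiModType S^c := (S^c)^o.

Definition right_ideal (S : pzSemiRingType) : Type :=
  submodClosed (right_regular S).

Definition congruence_semisimple (S : pzSemiRingType) : Prop :=
  exists (I : choiceType) (J : I -> right_ideal S),
    direct_sum J /\ forall i, congruence_simple (subsemimod (J i)).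

Section StronglyProjective.
Variable R : pzSemiRingType.
Implicit Types M N : lSemiModType R.

Lemma fgsp_iso M N :
  semimod_iso M N -> fg_strongly_projective M -> fg_strongly_projective N.
Proof.
move=> MN [D MD]; exists D.
exact: semimod_iso_trans (semimod_iso_sym MN) MD.
Qed.

Lemma fgsp_summand (D : free_summand R) :
  fg_strongly_projective (fs_semimod D).
Proof. by exists D; exact: semimod_iso_refl. Qed.

Definition fullpred M : {pred M} := [pred x | true].
Definition zeropred M : {pred M} := [pred x | x == 0].

Fact fullpred_closed M : GRing.subsemimod_closed (@fullpred M).
Proof. by []. Qed.

Fact zeropred_closed M : GRing.subsemimod_closed (@zeropred M).
Proof.
split=> [|a v]; last by rewrite !inE => /eqP->; rewrite scaler0.
by split=> [|u v]; rewrite !inE // => /eqP-> /eqP->; rewrite addr0.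
Qed.

HB.instance Definition _ M :=
  GRing.isSubSemiModClosed.Build R M (@fullpred M) (@fullpred_closed M).
HB.instance Definition _ M :=
  GRing.isSubSemiModClosed.Build R M (@zeropred M) (@zeropred_closed M).

Definition fullsub M : submodClosed M := @fullpred M : submodClosed _.
Definition zerosub M : submodClosed M := @zeropred M : submodClosed _.

Lemma fgsp_free n : fg_strongly_projective 'rV[R]_n.
Proof.
have dF : direct_summand (fullsub 'rV[R]_n).
  exists (zerosub 'rV[R]_n) => v; exists (v, 0); split.
    by split; rewrite ?inE ?addr0.
  by case=> [x y] [_ /= /eqP-> ->]; rewrite addr0.
apply: (@fgsp_iso (fs_semimod (FreeSummand dF))); last exact: fgsp_summand.
pose f (x : fs_semimod (FreeSummand dF)) : 'rV[R]_n := val x.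
have fl : GRing.semilinear_for *:%R f by [].
exists (HB.pack_for {linear _ -> _} f (GRing.isSemilinear.Build _ _ _ _ f fl)).
exists (fun v => exist _ v isT : fs_semimod (FreeSummand dF)) => // x.
exact: val_inj.
Qed.

Lemma fgsp_regular : fg_strongly_projective R^o.
Proof.
apply: fgsp_iso (fgsp_free 1).
pose f (x : 'rV[R]_1) : R^o := x 0 0.
have fl : GRing.semilinear_for *:%R f by split=> [a x|x y]; rewrite /f !mxE.
exists (HB.pack_for {linear _ -> _} f (GRing.isSemilinear.Build _ _ _ _ f fl)).
exists (fun a => \row_j a) => [x|a]; last by rewrite /= /f mxE.
by apply/rowP=> j; rewrite mxE ord1.
Qed.

Section Product.
Variables (m n : nat) (P : submodClosed 'rV[R]_m) (Q : submodClosed 'rV[R]_n).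

Definition prodpred : {pred 'rV[R]_(m + n)} :=
  fun x => (lsubmx x \in P) && (rsubmx x \in Q).

Fact prodpred_closed : GRing.subsemimod_closed prodpred.
Proof.
split=> [|a v]; last first.
  by case/andP=> vP vQ; apply/andP; split; rewrite linearZ rpredZ.
split=> [|u v]; first by apply/andP; split; rewrite raddf0 rpred0.
case/andP=> uP uQ /andP[vP vQ].
by apply/andP; split; rewrite raddfD rpredD.
Qed.

HB.instance Definition _ :=
  GRing.isSubSemiModClosed.Build R 'rV[R]_(m + n) prodpred prodpred_closed.

Definition prodsub : submodClosed 'rV[R]_(m + n) :=
  prodpred : submodClosed _.

End Product.

Lemma fgsp_prod M N : fg_strongly_projective M -> fg_strongly_projective N ->
  fg_strongly_projective (M * N)%type.
Proof.
case=> D MD [E NE]; set P := fs_pred D; set Q := fs_pred E.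
have sPQ : direct_summand (prodsub P Q).
  have [P' sP'] := fs_summand D; have [Q' sQ'] := fs_summand E.
  exists (prodsub P' Q') => v.
  have [p [[pP pP' vp] up]] := sP' (lsubmx v).
  have [q [[qQ qQ' vq] uq]] := sQ' (rsubmx v).
  exists (row_mx p.1 q.1, row_mx p.2 q.2); split.
    rewrite /in_mem /= /prodpred !row_mxKl !row_mxKr pP pP' qQ qQ'.
    by split=> //; rewrite add_row_mx -vp -vq hsubmxK.
  case=> x y [/andP[/= xP xQ] /andP[/= yP yQ] vE].
  have -> : p = (lsubmx x, lsubmx y).
    by apply: up; split=> //=; rewrite vE raddfD.
  have -> : q = (rsubmx x, rsubmx y).
    by apply: uq; split=> //=; rewrite vE raddfD.
  by rewrite /= !hsubmxK.
exists (FreeSummand sPQ).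
apply: semimod_iso_trans (semimod_iso_prod MD NE) _; apply: semimod_iso_sym.
pose f (x : fs_semimod (FreeSummand sPQ)) :
    fs_semimod D * fs_semimod E :=
  (exist _ (lsubmx (val x)) (andP (valP x)).1,
   exist _ (rsubmx (val x)) (andP (valP x)).2).
have fl : GRing.semilinear_for *:%R f.
  by split=> [a x|x y]; congr (_, _); apply: val_inj => /=;
    rewrite ?raddfD ?linearZ.
exists (HB.pack_for {linear _ -> _} f (GRing.isSemilinear.Build _ _ _ _ f fl)).
have h (x : subsemimod P * subsemimod Q) :
    row_mx (val x.1) (val x.2) \in prodsub P Q.
  rewrite /in_mem /= /prodpred row_mxKl row_mxKr.
  by apply/andP; split; apply: valP.
exists (fun x => exist (fun v => v \in prodsub P Q) _ (h x)) => [x|[x y]].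
  by apply: val_inj; rewrite /= hsubmxK.
by congr (_, _); apply: val_inj; rewrite /= ?row_mxKl ?row_mxKr.
Qed.

End StronglyProjective.

(* Isomorphism classes of finitely generated strongly projective              *)
(* semimodules.  Every such semimodule is isomorphic to a direct summand of   *)
(* some R^n, so the classes are taken on these summands, which, unlike        *)
(* [lSemiModType R], form a type of the same universe level as R.             *)
Section IsoClasses.
Variable R : pzSemiRingType.

HB.instance Definition _ := gen_eqMixin (free_summand R).
HB.instance Definition _ := gen_choiceMixin (free_summand R).

Definition fs_iso (D E : free_summand R) : bool :=
  `[< semimod_iso (fs_semimod D) (fs_semimod E) >].

Fact fs_iso_equiv : equiv_class_of fs_iso.
Proof.
split=> [D|D E|D E F]; rewrite /fs_iso.
- by apply/asboolP; exact: semimod_iso_refl.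
- by apply/asboolP/asboolP; exact: semimod_iso_sym.
- by move=> /asboolP DE /asboolP EF; apply/asboolP; exact: semimod_iso_trans EF.
Qed.

Canonical fs_iso_equiv_rel := EquivRelPack fs_iso_equiv.

Definition isoclass : Type := {eq_quot fs_iso}.
HB.instance Definition _ := Choice.on isoclass.

Definition iso_class (M : lSemiModType R) (pM : fg_strongly_projective M) :
  isoclass := \pi_({eq_quot fs_iso}) (projT1 (cid pM)).

Lemma iso_classP M N (pM : fg_strongly_projective M)
    (pN : fg_strongly_projective N) :
  iso_class pM = iso_class pN <-> semimod_iso M N.
Proof.
rewrite /iso_class; case: (cid pM) (cid pN) => D MD [E NE] /=.
split=> [/eqP|MN].
  rewrite eqquotE => /asboolP DE.
  apply: semimod_iso_trans MD (semimod_iso_trans DE _).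
  exact: semimod_iso_sym.
apply/eqP; rewrite eqquotE; apply/asboolP.
exact: semimod_iso_trans (semimod_iso_sym MD) (semimod_iso_trans MN NE).
Qed.

Lemma iso_class_repr (x : isoclass) :
  iso_class (fgsp_summand (repr x)) = x.
Proof.
rewrite /iso_class; case: cid => D rD /=; rewrite -[RHS]reprK.
by apply/eqP; rewrite eqquotE; apply/asboolP/semimod_iso_sym.
Qed.

Lemma iso_class_surj (x : isoclass) :
  exists M (pM : fg_strongly_projective M), x = iso_class pM.
Proof.
exists (fs_semimod (repr x)), (fgsp_summand (repr x)).
by rewrite iso_class_repr.
Qed.

Definition isoclass_zero : isoclass := iso_class (fgsp_free R 0).

Definition isoclass_add (x y : isoclass) : isoclass :=
  iso_class (fgsp_prod (fgsp_summand (repr x)) (fgsp_summand (repr y))).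

Lemma isoclass_addE M N (pM : fg_strongly_projective M)
    (pN : fg_strongly_projective N) :
  isoclass_add (iso_class pM) (iso_class pN) = iso_class (fgsp_prod pM pN).
Proof.
have rK L (pL : fg_strongly_projective L) :
    semimod_iso (fs_semimod (repr (iso_class pL))) L.
  by apply/(iso_classP (fgsp_summand _) pL); exact: iso_class_repr.
by apply/iso_classP; apply: semimod_iso_prod; exact: rK.
Qed.

Fact isoclass_addA : associative isoclass_add.
Proof.
move=> x y z; have [M [pM ->]] := iso_class_surj x.
have [N [pN ->]] := iso_class_surj y; have [L [pL ->]] := iso_class_surj z.
rewrite !isoclass_addE; apply/iso_classP; exact: semimod_iso_prodA.
Qed.

Fact isoclass_addC : commutative isoclass_add.
Proof.
move=> x y; have [M [pM ->]] := iso_class_surj x.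
have [N [pN ->]] := iso_class_surj y.
rewrite !isoclass_addE; apply/iso_classP; exact: semimod_iso_prodC.
Qed.

Fact isoclass_add0 : left_id isoclass_zero isoclass_add.
Proof.
move=> x; have [M [pM ->]] := iso_class_surj x.
rewrite isoclass_addE; apply/iso_classP.
exists (snd : {linear ('rV[R]_0 * M)%type -> M}).
by exists (fun y => (0, y)) => [[u y]|y] //=; rewrite [u]thinmx0.
Qed.

HB.instance Definition _ := GRing.isNmodule.Build isoclass
  isoclass_addA isoclass_addC isoclass_add0.

End IsoClasses.

(* Group completion of a commutative monoid; the class of (a, b) stands for   *)
(* the formal difference a - b.                                               *)
Section GrothendieckGroup.
Variable V : nmodType.

Definition groth_eq (x y : V * V) : bool :=
  `[< exists k, x.1 + y.2 + k = y.1 + x.2 + k >].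

Fact groth_equiv : equiv_class_of groth_eq.
Proof.
split=> [x|x y|y x z]; first by apply/asboolP; exists 0.
  by apply/asboolP/asboolP => -[k e]; exists k.
case: x y z => [x1 x2] [y1 y2] [z1 z2].
move=> /asboolP[/= k e] /asboolP[/= l f]; apply/asboolP.
exists (y1 + y2 + k + l) => /=.
rewrite !addrA [LHS](ACl (1*4*5*(3*2*6))) /= e f.
by rewrite !addrA [LHS](ACl (4*2*1*5*3*6)).
Qed.

Canonical groth_equiv_rel := EquivRelPack groth_equiv.

Definition groth : Type := {eq_quot groth_eq}.
HB.instance Definition _ := Choice.on groth.

Definition groth_pi (x : V * V) : groth := \pi_({eq_quot groth_eq}) x.

Lemma groth_piP x y : groth_pi x = groth_pi y <->
  exists k, x.1 + y.2 + k = y.1 + x.2 + k.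
Proof.
split=> [/eqP|e]; first by rewrite eqquotE => /asboolP.
by apply/eqP; rewrite eqquotE; apply/asboolP.
Qed.

Lemma groth_pi_repr (x : groth) : groth_pi (repr x) = x.
Proof. exact: reprK. Qed.

Definition groth_zero : groth := groth_pi (0, 0).
Definition groth_opp (x : groth) : groth := groth_pi ((repr x).2, (repr x).1).
Definition groth_add (x y : groth) : groth := groth_pi (repr x + repr y).

Lemma groth_oppE x : groth_opp (groth_pi x) = groth_pi (x.2, x.1).
Proof.
have /groth_piP[k e] := groth_pi_repr (groth_pi x).
apply/groth_piP; exists k => /=.
by rewrite [LHS](ACl (2*1*3)) /= [RHS](ACl (2*1*3)).
Qed.

Lemma groth_addE x y : groth_add (groth_pi x) (groth_pi y) = groth_pi (x + y).
Proof.
have /groth_piP[k e] := groth_pi_repr (groth_pi x).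
have /groth_piP[l f] := groth_pi_repr (groth_pi y).
apply/groth_piP; exists (k + l) => /=; rewrite !addrA.
rewrite [LHS](ACl (1*3*5*(2*4*6))) /= e f !addrA.
by rewrite [LHS](ACl (1*4*2*5*3*6)).
Qed.

Fact groth_addA : associative groth_add.
Proof.
move=> x y z; rewrite -(groth_pi_repr x) -(groth_pi_repr y).
by rewrite -(groth_pi_repr z) !groth_addE addrA.
Qed.

Fact groth_addC : commutative groth_add.
Proof. by move=> x y; rewrite /groth_add addrC. Qed.

Fact groth_add0 : left_id groth_zero groth_add.
Proof. by move=> x; rewrite -(groth_pi_repr x) groth_addE add0r. Qed.

Fact groth_addN : left_inverse groth_zero groth_opp groth_add.
Proof.
move=> x; rewrite -(groth_pi_repr x) groth_oppE groth_addE.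
by apply/groth_piP; exists 0 => /=; rewrite !addr0 add0r addrC.
Qed.

HB.instance Definition _ := GRing.isZmodule.Build groth
  groth_addA groth_addC groth_add0 groth_addN.

Definition groth_class (a : V) : groth := groth_pi (a, 0).

Fact groth_class_nmod_morphism : nmod_morphism groth_class.
Proof.
split=> [|a b] //; rewrite [RHS]groth_addE; congr groth_pi.
by congr (_, _); rewrite addr0.
Qed.

HB.instance Definition _ :=
  GRing.isNmodMorphism.Build V groth groth_class groth_class_nmod_morphism.

Lemma groth_class_eq a b :
  groth_class a = groth_class b <-> exists k, a + k = b + k.
Proof.
split=> [/groth_piP[k]|[k e]]; last first.
  by apply/groth_piP; exists k; rewrite /= !addr0.
by rewrite /= !addr0 => e; exists k.
Qed.

Lemma groth_classB (x : groth) : exists a b, x = groth_class a - groth_class b.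
Proof.
exists (repr x).1, (repr x).2; rewrite -[LHS]groth_pi_repr.
rewrite [- _]groth_oppE [RHS]groth_addE; congr groth_pi.
by case: (repr x) => a b /=; congr (_, _); rewrite /= ?addr0 ?add0r.
Qed.

End GrothendieckGroup.

Section SK0.
Variable S : pzSemiRingType.

Definition SK0 : zmodType := groth (isoclass S^c).

Definition SK0_class (P : lSemiModType S^c)
    (pP : fg_strongly_projective P) : SK0 := groth_class (iso_class pP).

Definition SK0_pos : set SK0 :=
  [set x | exists (P : lSemiModType S^c) (pP : fg_strongly_projective P),
             x = SK0_class pP].

Lemma fgsp_right_regular : fg_strongly_projective (right_regular S).
Proof. exact: fgsp_regular. Qed.

Definition SK0_unit : SK0 := SK0_class fgsp_right_regular.

End SK0.

Arguments SK0_pos S : clear implicits.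
Arguments SK0_unit S : clear implicits.

Definition SK0_iso (S T : pzSemiRingType) : Prop :=
  exists f : {additive SK0 S -> SK0 T},
    [/\ bijective f,
        f (SK0_unit S) = SK0_unit T &
        f @` SK0_pos S = SK0_pos T].

(* The Boolean semifield: max = || and min = && on {false < true}.  An alias  *)
(* of bool is needed since bool itself carries the xor structure of F_2.      *)
Definition boolean : Type := bool.
HB.instance Definition _ := Countable.on boolean.
HB.instance Definition _ := GRing.isNmodule.Build boolean orbA orbC orFb.
HB.instance Definition _ := GRing.Nmodule_isComNzSemiRing.Build boolean
  andbA andbC andTb andb_orl andFb isT.

(* An additively idempotent semiring S with its unique B-algebra structure.   *)
(* MathComp's [semiAlgType] requires 1 != 0, which S need not satisfy, so the *)
(* compatibility of the scaling with products is given as lemmas.             *)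
Definition Balgebra (S : pzSemiRingType) (idS : forall s : S, s + s = s) :
  Type := S.

Section Balgebra.
Variables (S : pzSemiRingType) (idS : forall s : S, s + s = s).
Local Notation A := (Balgebra idS).

HB.instance Definition _ := GRing.PzSemiRing.on A.

Definition Bscale (b : boolean) (s : A) : A := if b then s else 0.

Fact BscaleA b c s : Bscale b (Bscale c s) = Bscale (b * c) s.
Proof. by case: b; case: c. Qed.
Fact Bscale0 s : Bscale 0 s = 0. Proof. by []. Qed.
Fact Bscale1 : left_id 1 Bscale. Proof. by []. Qed.
Fact BscaleDr : right_distributive Bscale +%R.
Proof. by case=> s t //=; rewrite addr0. Qed.
Fact BscaleDl s : {morph Bscale^~ s : b c / b + c}.
Proof. by case=> -[]; rewrite /Bscale /= ?addr0 ?add0r // [RHS]idS. Qed.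

HB.instance Definition _ := GRing.Nmodule_isLSemiModule.Build boolean A
  BscaleA Bscale0 Bscale1 BscaleDr BscaleDl.

Lemma BscaleAl (b : boolean) (s t : A) : b *: (s * t) = (b *: s) * t.
Proof. by case: b => //; rewrite [RHS]mul0r. Qed.
Lemma BscaleAr (b : boolean) (s t : A) : b *: (s * t) = s * (b *: t).
Proof. by case: b => //; rewrite [RHS]mulr0. Qed.

End Balgebra.

Definition Balgebra_iso (S T : pzSemiRingType) (idS : forall s : S, s + s = s)
    (idT : forall t : T, t + t = t) : Prop :=
  exists g : {rmorphism Balgebra idS -> Balgebra idT},
    scalable g /\ bijective g.

Section Idempotent.
Variable R : pzSemiRingType.
Implicit Types M : lSemiModType R.

(* The archimedean preorder: the equivalence it induces is a congruence that  *)
(* identifies x and x + x, and 0 only with 0 when M is zerosumfree.           *)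
Definition arch_le M (x y : M) := exists z n, x + z = y *+ n.

Lemma congruence_simple_idem M :
  (forall x y : M, x + y = 0 -> x = 0 /\ y = 0) ->
  congruence_simple M -> forall x : M, x + x = x.
Proof.
move=> zM [[x0 nz] sM].
pose r (x y : M) := arch_le x y /\ arch_le y x.
have rr x : arch_le x x by exists 0, 1%N; rewrite addr0.
have tr x y z : arch_le x y -> arch_le y z -> arch_le x z.
  move=> [u [m e]] [v [n f]]; exists (u + v *+ m), (n * m)%N.
  by rewrite addrA e -mulrnDl f mulrnA.
have ad x y x' y' : arch_le x y -> arch_le x' y' -> arch_le (x + x') (y + y').
  move=> [u [m e]] [v [n f]].
  exists (u + y *+ n + (v + y' *+ m)), (m + n)%N.
  rewrite !addrA [LHS](ACl (1*3*4*(2*5)*6)) /= e f.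
  by rewrite -mulrnDr -addrA -mulrnDr mulrnDl addnC.
have cr : congruence r.
  split.
  - by [].
  - by move=> x y [].
  - by move=> x y z [? ?] [? ?]; split; apply: tr; eassumption.
  - by move=> x y x' y' [? ?] [? ?]; split; apply: ad.
  - by move=> a x y [[u [m e]] [v [n f]]]; split;
      [exists (a *: u), m | exists (a *: v), n];
      rewrite -scalerDr ?e ?f scalerMnr.
case: (sM r cr) => [ri x|rt].
  apply/ri; split; first by exists 0, 2%N; rewrite addr0 mulr2n.
  by exists x, 1%N.
have [[u [m e]] _] := rt x0 0.
by move: e; rewrite mul0rn => /zM[x00]; rewrite x00 eqxx in nz.
Qed.

End Idempotent.

Lemma congruence_semisimple_idem (S : pzSemiRingType) :
  zerosumfree S -> congruence_semisimple S -> forall s : S, s + s = s.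
Proof.
move=> zS [I [J [dJ sJ]]] s.
have idJ i (y : right_regular S) : y \in J i -> y + y = y.
  move=> yJ; have zJ (u v : subsemimod (J i)) : u + v = 0 -> u = 0 /\ v = 0.
    by move=> /(congr1 val)/zS[u0 v0]; split; apply: val_inj.
  pose z : subsemimod (J i) := exist _ y yJ.
  exact: (congr1 val (congruence_simple_idem zJ (sJ i) z)).
have [x [[xJ _ ->] _]] := dJ s.
rewrite -[LHS]big_split; apply: eq_bigr => i _; exact: idJ (xJ i).
Qed.

(* Main.v *)
(* Write 1 = e_1 + ... + e_n with orthogonal idempotents e_i such that the
   right ideals e_i S are congruence-simple.  The congruences a x = a y (for a
   in S) and "x s e_k = 0 iff y s e_k = 0 for all s" show that each corner
   e_i S e_j contains at most one nonzero element, that products of nonzero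
   elements of composable corners are nonzero, and that e_i S e_j <> 0 is an
   equivalence relation in (i, j).  Hence s |-> (e_i s e_j <> 0)_{i,j}
   identifies S with the Boolean matrices supported on the blocks of this
   relation, i.e. with a finite product of matrix semirings over B.  Likewise a
   direct summand of S^n is spanned by the vectors e_i at position a that it
   contains, so it is determined up to isomorphism by the number of these
   vectors in each block.  The isomorphism classes thus form the monoid N^C, C
   the set of blocks, with [S] the vector of block sizes.  As N^C is
   cancellative it is the positive cone of SK_0(S), and an isomorphism
   N^C -> N^C' permutes the irreducible elements, i.e. the basis vectors. *)

Require Import Defs.
From mathcomp Require Import all_boot all_algebra.
From HB Require Import structures.
From mathcomp Require Import boolp classical_sets cardinality fsbigop.

Set Implicit Arguments.
Unset Strict Implicit.
Unset Printing Implicit Defensive.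

Import GRing.Theory.

Local Open Scope ring_scope.

(* [phi] identifies S with the I x I Boolean matrices supported on the blocks
   {(i, j) | cl i = cl j}. *)
Record bool_coords (S : pzSemiRingType) (I C : finType) (cl : I -> C)
    (phi : S -> I -> I -> bool) : Prop := BoolCoords {
  bc_surj : forall c, exists i, cl i = c;
  bc_inj : forall s t, (forall i j, phi s i j = phi t i j) -> s = t;
  bc_cl : forall s i j, phi s i j -> cl i = cl j;
  bc_onto : forall A : I -> I -> bool, (forall i j, A i j -> cl i = cl j) ->
    exists s, forall i j, phi s i j = A i j;
  bc_add : forall s t i j, phi (s + t) i j = phi s i j || phi t i j;
  bc_mul : forall s t i k, phi (s * t) i k = [exists j, phi s i j && phi t j k];
  bc_one : forall i j, phi 1 i j = (i == j)
}.

(** * Corners cut out by orthogonal idempotents with congruence-simple right ideals *)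

Section Structure.
Variables (S : pzSemiRingType) (zS : zerosumfree S).

Lemma zerosumfree_sum (I : finType) (P : pred I) (F : I -> S) :
  \sum_(i | P i) F i = 0 -> forall i, P i -> F i = 0.
Proof. by move=> F0 i Pi; move: F0; rewrite (bigD1 i) //= => /zS[]. Qed.

Variables (I : finType) (e : I -> S).
Hypotheses (e1 : \sum_i e i = 1) (ee : forall i, e i * e i = e i)
  (e_orth : forall i j, i != j -> e i * e j = 0) (e_neq0 : forall i, e i != 0)
  (simple_e : forall i (r : right_regular S -> right_regular S -> Prop),
    congruence r ->
    (forall x y, e i * x = x -> e i * y = y -> r x y -> x = y) \/
    (forall x y, e i * x = x -> e i * y = y -> r x y)).

(** The relation identifying [x] and [y] when [a * x = a * y] is a congruence. If it were total on
    the right ideal of [e j], it would relate [e j] to 0 and give [a = a * e j = 0]; by simplicity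
    it is therefore trivial there. *)
Lemma corner_mul_inj i j (a x y : S) : a != 0 -> a = e i * a * e j ->
  e j * x = x -> e j * y = y -> a * x = a * y -> x = y.
Proof.
move=> a0 aE xj yj axy.
pose r (x y : right_regular S) := a * (x : S) = a * (y : S) :> S.
have cr : congruence r.
  split=> [//|//|u v w /= h1 h2|u v u' v' h1 h2|b u v h].
  - by rewrite /r h1.
  - by rewrite /r !mulrDr h1 h2.
  - by rewrite /r -[b *: u]/((u : S) * b) -[b *: v]/((v : S) * b) !mulrA h.
case: (simple_e j cr) => [h|h]; first exact: h.
have := h (e j) 0 (ee j) (mulr0 _); rewrite /r mulr0 => h0.
have a00 : a = 0 by rewrite aE -[e i * a * e j]mulrA h0 mulr0.
by rewrite a00 eqxx in a0.
Qed.

(** Having the same annihilators into column [k] is a congruence; compatibility with sums is where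
    zerosumfreeness enters. The witness [s0] separates [e i] from 0, so the congruence is not total
    on the right ideal of [e i]. *)
Lemma corner_ann i k x y : (exists s, e i * s * e k != 0) ->
  e i * x = x -> e i * y = y ->
  (forall s, x * s * e k = 0 <-> y * s * e k = 0) -> x = y.
Proof.
move=> [s0 s00] xi yi ann.
pose r (x y : right_regular S) :=
  forall s, (x : S) * s * e k = 0 <-> (y : S) * s * e k = 0.
have cr : congruence r.
  split=> [//|u v h s|u v w h1 h2 s|u v u' v' h1 h2 s|b u v h s].
  - by split=> /h.
  - by split=> [/h1/h2|/h2/h1].
  - rewrite !mulrDl; split=> /zS[/h1 E1 /h2 E2]; by rewrite E1 E2 addr0.
  - rewrite -[b *: u]/((u : S) * (b : S)) -[b *: v]/((v : S) * (b : S)).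
    by have := h ((b : S) * s); rewrite !mulrA.
case: (simple_e i cr) => [h|h]; first exact: h.
have [_] := h (e i) 0 (ee i) (mulr0 _) s0.
by rewrite !mul0r => /(_ erefl) h0; rewrite h0 eqxx in s00.
Qed.

(** By injectivity of left multiplication, every nonzero element of the corner annihilates exactly
    the [s] with [e j * s = 0]. So [a] and [b] have the same annihilators and [corner_ann]
    identifies them. *)
Lemma corner_uniq i j (a b : S) : a != 0 -> b != 0 ->
  e i * a * e j = a -> e i * b * e j = b -> a = b.
Proof.
have ann c s : c != 0 -> e i * c * e j = c -> c * s = 0 <-> e j * s = 0.
  move=> c0 cE; have cj : c * s = c * (e j * s).
    by rewrite -cE -!mulrA (mulrA (e j)) ee.
  split=> [cs|es]; last by rewrite cj es mulr0.
  apply: (corner_mul_inj c0 (esym cE)); rewrite ?mulrA ?ee ?mulr0 //.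
  by rewrite -mulrA -cj.
have fixi c : e i * c * e j = c -> e i * c = c.
  by move=> <-; rewrite !mulrA ee.
move=> a0 b0 aE bE; apply: (@corner_ann i j); [|exact: fixi|exact: fixi|].
  by exists a; rewrite aE.
by move=> s; rewrite -!mulrA !ann.
Qed.

Lemma corner_mul_neq0 i j k (a b : S) : a != 0 -> b != 0 ->
  e i * a * e j = a -> e j * b * e k = b -> a * b != 0.
Proof.
move=> a0 b0 aE bE; apply/eqP => ab0; move/eqP: b0; apply.
apply: (corner_mul_inj a0 (esym aE)); rewrite ?mulr0 //.
by rewrite -bE !mulrA ee.
Qed.

Definition corner s i j : bool := e i * s * e j != 0.

(** If all corners at [(j, i)] vanished, [e i * s * e j] would have the annihilators of 0 into
    column [i], hence be 0. *)
Lemma corner_sym s i j : corner s i j -> exists t, corner t j i.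
Proof.
move=> sij; apply: contrapT => no.
have sE : e i * s * e j = 0; last by move: sij; rewrite /corner sE eqxx.
apply: (@corner_ann i i); rewrite ?mulr0 //.
- by exists 1; rewrite mulr1 ee.
- by rewrite !mulrA ee.
move=> t; rewrite !mul0r; split=> // _.
have [h|h] := eqVneq (e j * t * e i) 0.
  by rewrite -!mulrA !(mulrA (e j)) h !mulr0.
by case: no; exists t.
Qed.

Lemma decompose s : s = \sum_i \sum_j e i * s * e j.
Proof.
rewrite -[LHS]mul1r -[LHS]mulr1 -e1 !mulr_suml; apply: eq_bigr => i _.
by rewrite mulr_sumr.
Qed.

(** Inserting [1 = \sum_j e j] turns the corner of a product into a sum of products of corners.
    Zerosumfreeness rules out cancellation between the terms, and [corner_mul_neq0] makes each term
    nonzero as soon as both factors are. *)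
Lemma corner_mul s t i k :
  corner (s * t) i k = [exists j, corner s i j && corner t j k].
Proof.
have E : e i * (s * t) * e k = \sum_j (e i * s * e j) * (e j * t * e k).
  rewrite -{1}[s]mulr1 -e1 mulr_sumr mulr_suml mulr_sumr mulr_suml.
  by apply: eq_bigr => j _; rewrite !mulrA -(mulrA _ (e j) (e j)) ee.
have fx (i0 j0 : I) u : e i0 * (e i0 * u * e j0) * e j0 = e i0 * u * e j0.
  by rewrite !mulrA ee -mulrA ee.
apply/idP/existsP => [|[j /andP[sij tjk]]]; rewrite /corner E.
  move/eqP=> sum_neq0; apply: contrapT => no; apply: sum_neq0.
  rewrite big1 // => j _; apply/eqP/negPn/negP => h; apply: no; exists j.
  apply/andP; split; apply: contraNN h => /eqP->; by rewrite ?mulr0 ?mul0r.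
apply/eqP => /zerosumfree_sum/(_ j isT)/eqP; apply/negP.
by apply: (corner_mul_neq0 sij tjk); apply: fx.
Qed.

Definition linked i j : bool := `[< exists s, corner s i j >].

Lemma linked_refl i : linked i i.
Proof. by apply/asboolP; exists 1; rewrite /corner mulr1 ee. Qed.

Lemma linked_sym i j : linked i j = linked j i.
Proof. by apply/asboolP/asboolP => -[s /corner_sym]. Qed.

Lemma linked_trans i j k : linked i j -> linked j k -> linked i k.
Proof.
move=> /asboolP[s sij] /asboolP[t tjk]; apply/asboolP; exists (s * t).
by rewrite corner_mul; apply/existsP; exists j; rewrite sij.
Qed.

Definition link_class i : {set I} := [set j | linked i j]%SET.

Lemma link_classP i j : link_class i = link_class j <-> linked i j.
Proof.
split=> [/finset.setP/(_ j)|ij]; first by rewrite !finset.in_set linked_refl.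
apply/finset.setP => k; rewrite !finset.in_set; apply/idP/idP; last first.
  exact: linked_trans ij.
by apply: linked_trans; rewrite linked_sym.
Qed.

(** [C] is the image of [link_class], so that [cl] is surjective. Faithfulness of the coordinates
    comes from [decompose] and the uniqueness of nonzero corner elements. *)
Lemma corner_coords :
  exists (C : finType) (cl : I -> C), bool_coords cl corner.
Proof.
exists {A : {set I} | A \in codom link_class}.
exists (fun i => exist _ (link_class i) (codom_f link_class i)).
have clE i j :
    (exist (fun A => A \in codom link_class) (link_class i)
       (codom_f link_class i) =
     exist _ (link_class j) (codom_f link_class j)) <-> linked i j.
  rewrite -link_classP; split=> [[]//|h]; exact: val_inj.
split.
- case=> A Acod; have /codomP[i Ai] := Acod; exists i; exact/val_inj/esym.
- move=> s t st; rewrite [s]decompose [t]decompose.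
  apply: eq_bigr => i _; apply: eq_bigr => j _.
  have := st i j; rewrite /corner.
  have [->|s0] := eqVneq; first by case: eqVneq => // ->.
  have [//|t0 _] := eqVneq.
  by apply: (@corner_uniq i j); rewrite // !mulrA ee -mulrA ee.
- by move=> s i j sij; apply/clE/asboolP; exists s.
- move=> A Acl.
  (* Choose the nonzero element of each corner prescribed by [A]; the preimage of [A] is their
     sum. *)
  have u_ex i j : exists u, A i j -> (e i * u * e j = u /\ u != 0).
    case Aij: (A i j); last by exists 0.
    have /clE/asboolP[s sij] := Acl _ _ Aij; exists (e i * s * e j) => _.
    by rewrite !mulrA ee -mulrA ee.
  have [u uE] := choice (fun p : I * I => u_ex p.1 p.2).
  exists (\sum_i \sum_(j | A i j) u (i, j)) => i j.
  have uA k l : A k l -> e i * u (k, l) * e j =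
      if (k == i) && (l == j) then u (k, l) else 0.
    move=> /(uE (k, l)) /= [ukl _].
    case: (eqVneq k i) => [ki|nki] /=; last first.
      by rewrite -ukl !mulrA e_orth ?mul0r // eq_sym.
    case: (eqVneq l j) => [lj|nlj] /=; first by rewrite -ki -lj.
    by rewrite -ukl -!mulrA e_orth ?mulr0.
  (* Orthogonality removes every term except the one at [(i, j)]. *)
  have -> : corner (\sum_i \sum_(j | A i j) u (i, j)) i j =
      (\sum_(k | k == i) \sum_(l | A k l && (l == j)) u (k, l) != 0).
    rewrite /corner; congr (_ != _); rewrite mulr_sumr mulr_suml.
    rewrite [RHS]big_mkcond.
    apply: eq_bigr => k _; rewrite mulr_sumr mulr_suml.
    case: ifP => ki; last by rewrite big1 // => l /uA->; rewrite ki.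
    by rewrite big_mkcondr; apply: eq_bigr => l /uA->; rewrite ki.
  rewrite big_pred1_eq.
  case Aij: (A i j).
    rewrite (big_pred1 j) => [|l /=]; last first.
      by case: eqVneq => [->|]; rewrite ?Aij ?andbF.
    by case: (uE (i, j) Aij).
  rewrite big1 ?eqxx // => l /andP[Ail /eqP lj]; by rewrite lj Aij in Ail.
- move=> s t i j; rewrite /corner mulrDr mulrDl -negb_and; congr (~~ _).
  apply/eqP/andP => [/zS[-> ->]|[/eqP-> /eqP->]]; by rewrite ?eqxx ?addr0.
- exact: corner_mul.
- move=> i j; rewrite /corner mulr1; have [->|/e_orth->] := eqVneq i j.
    by rewrite ee e_neq0.
  by rewrite eqxx.
Qed.

End Structure.

(** * From a semisimple decomposition to orthogonal idempotents *)

Lemma fsumT_seq (M : nmodType) (K : choiceType) (l : seq K) (F : K -> M) :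
  uniq l -> (forall k, k \notin l -> F k = 0) ->
  \sum_(k \in [set: K]) F k = \sum_(k <- l) F k.
Proof.
move=> ul F0; rewrite (fsbig_seq _ _ ul); symmetry; apply: fsbig_widen => //.
by move=> k [_ /negP]; exact: F0.
Qed.

(** The idempotents are the nonzero components of 1 in the direct sum. Idempotence and orthogonality
    both follow from uniqueness of decompositions, via [mulx]. *)
Lemma semisimple_coords (S : pzSemiRingType) :
  zerosumfree S -> congruence_semisimple S ->
  exists (I C : finType) (cl : I -> C) phi, @bool_coords S I C cl phi.
Proof.
move=> zS [K [J [dJ sJ]]].
have [x0 [[x0J x0fin x01] _]] := dJ (1 : S).
(* Typing x in S rules out the reversed product of the ring structure of S^c. *)
pose x : K -> S := x0.
have xJ i : (x i : right_regular S) \in J i := x0J i.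
have xfin : finite_set [set i | x i != 0]%classic := x0fin.
have x1 : 1 = \sum_(i \in [set: K]) x i := x01.
(* Simplicity of [J k] is applied to restrictions of congruences of the whole right semimodule S. *)
have simple_fix k (r : right_regular S -> right_regular S -> Prop) :
    congruence r ->
    (forall y z, y \in J k -> z \in J k -> r y z -> y = z) \/
    (forall y z, y \in J k -> z \in J k -> r y z).
  move=> cr; pose r' (y z : subsemimod (J k)) := r (val y) (val z).
  have cr' : congruence r'.
    split=> [y|y z|y z w|y z y' z'|a y z]; rewrite /r' /=.
    - exact: congr_refl.
    - exact: congr_sym.
    - exact: congr_trans.
    - exact: congr_add.
    - exact: congr_scale.
  have [_ /(_ r' cr')[h|h]] := sJ k.
    left=> y z yJ zJ yz.
    by have /(congr1 val) := (h (exist _ y yJ) (exist _ z zJ)).1 yz.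
  by right=> y z yJ zJ; exact: (h (exist _ y yJ) (exist _ z zJ)).
have mulJ k (y s : S) : (y : right_regular S) \in J k ->
    (y * s : right_regular S) \in J k.
  by move=> yJ; exact: (@rpredZ _ _ (J k) (s : S^c) (y : right_regular S)).
have [l0 xl0] := (finite_seqP _).1 xfin.
pose l := undup l0; have ul : uniq l := undup_uniq l0.
have xl k : (k \in l) = (x k != 0).
  rewrite mem_undup; apply/idP/idP => h.
    by have : [set` l0]%classic k by []; rewrite -xl0.
  by have : [set i | x i != 0]%classic k by []; rewrite xl0.
have sum_l (F : K -> S) : (forall k, k \notin l -> F k = 0) ->
    \sum_(k \in [set: K]) F k = \sum_(k <- l) F k.
  exact: fsumT_seq.
(* An element [y] of [J k] decomposes both as itself in position [k] and, multiplying the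
   decomposition of 1 by [y], as the family [x j * y]; the two families coincide. *)
have mulx k (y : S) j : (y : right_regular S) \in J k ->
    x j * y = if j == k then y else 0.
  move=> yJ; have [z [_ zU]] := dJ y.
  have <- : z j = if j == k then y else 0.
    rewrite (_ : z = (fun j => if j == k then y else 0)) //.
    apply: zU; split.
    - by move=> i; case: eqVneq => [->|_] //; exact: (rpred0 (J i)).
    - apply: (sub_finite_set _ (finite_set1 k)) => i /=.
      by case: (eqVneq i k); rewrite ?eqxx.
    - rewrite (@fsumT_seq _ _ [:: k]) ?big_seq1 ?eqxx // => i.
    by rewrite inE; case: eqVneq.
  rewrite (_ : z = (fun j => x j * y)) //.
  apply: zU; split.
  - by move=> i; exact: (mulJ _ _ _ (xJ i)).
  - apply: (sub_finite_set _ xfin) => i /=; apply: contraNN => /eqP->.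
    by rewrite mul0r.
  - rewrite -[LHS]mul1r [X in X * _]x1 !sum_l ?mulr_suml // => i.
      by rewrite xl negbK => /eqP->; rewrite mul0r.
    by rewrite xl negbK => /eqP.
have memJ k (y : S) : x k * y = y -> (y : right_regular S) \in J k.
  by move=> <-; exact: (mulJ _ _ _ (xJ k)).
pose t := in_tuple l; pose e (i : 'I_(size l)) : S := x (tnth t i).
have tinj : injective (tnth t) by exact/tuple_uniqP.
have e1 : \sum_i e i = 1.
  rewrite -(big_tnth _ _ l xpredT x) -sum_l // => k.
  by rewrite xl negbK => /eqP.
have ee i : e i * e i = e i by rewrite (mulx _ _ _ (xJ _)) eqxx.
have e_orth i j : i != j -> e i * e j = 0.
  by move=> ij; rewrite (mulx _ _ _ (xJ _)) (inj_eq tinj) (negPf ij).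
have e_neq0 i : e i != 0 by rewrite -xl mem_tnth.
have [] := @corner_coords S zS _ e e1 ee e_orth e_neq0.
  move=> i r /(simple_fix (tnth t i))[h|h]; [left|right] => y z yE zE.
    by apply: h; exact: memJ.
  by apply: h; exact: memJ.
by move=> C [cl h]; exists 'I_(size l), C, cl, (corner e).
Qed.

(** * Multiplicities of labels *)

Definition mult (X C : finType) (lab : X -> C) : {ffun C -> nat} :=
  [ffun c => #|[set x | lab x == c]%SET|].

(** Corresponding fibres have equal size, so an element is sent to the element of the same rank in
    the other fibre. *)
Lemma mult_bij (X X' C : finType) (lab : X -> C) (lab' : X' -> C) :
  mult lab = mult lab' ->
  exists2 t : X -> X', bijective t & forall x, lab' (t x) = lab x.
Proof.
move=> /ffunP mE; pose fib c := [set x | lab x == c]%SET.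
pose fib' c := [set x | lab' x == c]%SET.
have cE c : #|fib c| = #|fib' c| by have := mE c; rewrite !ffunE.
have fibP x : x \in fib (lab x) by rewrite inE.
pose t x : X' := enum_val (cast_ord (cE _) (enum_rank_in (fibP x) x)).
have tlab x : lab' (t x) = lab x.
  have := enum_valP (cast_ord (cE _) (enum_rank_in (fibP x) x)).
  by rewrite inE => /eqP.
have tinj : injective t.
  move=> x y txy; have xy : lab x = lab y by rewrite -!tlab txy.
  move: txy; rewrite /t; move: (fibP x) (fibP y); rewrite -xy => px py.
  by move=> /enum_val_inj/cast_ord_inj/enum_rank_in_inj; apply.
have card_sum (Y : finType) (l : Y -> C) :
    #|Y| = (\sum_c #|[set y | l y == c]%SET|)%N.
  rewrite -sum1_card (partition_big l xpredT) //=; apply: eq_bigr => c _.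
  by rewrite sum1dep_card.
exists t => //; apply: inj_card_bij => //.
rewrite (card_sum _ lab) (card_sum _ lab') leq_eqVlt.
by apply/orP; left; apply/eqP/esym/eq_bigr => c _; exact: cE.
Qed.

(** * Boolean coordinates on semimodules and on summands of free ones *)

Section ModuleCoords.
Variables (S : pzSemiRingType) (I C : finType) (cl : I -> C)
  (phi : S -> I -> I -> bool) (Sphi : bool_coords cl phi).

(* [Phi] identifies M with the X x I Boolean matrices supported on
   {(x, j) | lab x = cl j}, on which S acts on the right by Boolean matrix
   product. *)
Record mod_coords (M : lSemiModType S^c) (X : finType) (lab : X -> C)
    (Phi : M -> X -> I -> bool) : Prop := ModCoords {
  mc_inj : forall u v, (forall x j, Phi u x j = Phi v x j) -> u = v;
  mc_lab : forall v x j, Phi v x j -> lab x = cl j;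
  mc_onto : forall A : X -> I -> bool, (forall x j, A x j -> lab x = cl j) ->
    exists v, forall x j, Phi v x j = A x j;
  mc_add : forall u v x j, Phi (u + v) x j = Phi u x j || Phi v x j;
  mc_scale : forall (s : S) v x k,
    Phi ((s : S^c) *: v) x k = [exists j, Phi v x j && phi s j k]
}.

Definition has_coords (M : lSemiModType S^c) (X : finType) (lab : X -> C) :
    Prop :=
  exists Phi, @mod_coords M X lab Phi.

Lemma coords_iso M M' (X : finType) (lab : X -> C) :
  has_coords M lab -> has_coords M' lab -> semimod_iso M M'.
Proof.
move=> [P hP] [Q hQ].
have [f fE] := choice (fun v : M => mc_onto hQ (@mc_lab _ _ _ _ hP v)).
have [g gE] := choice (fun v : M' => mc_onto hP (@mc_lab _ _ _ _ hQ v)).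
have fl : GRing.semilinear_for *:%R f.
  split=> [a u|u v]; apply: (mc_inj hQ) => x j.
    rewrite fE (mc_scale hP) (mc_scale hQ); apply: eq_existsb => k.
    by rewrite fE.
  by rewrite fE (mc_add hP) (mc_add hQ) !fE.
exists (HB.pack_for {linear M -> M'} f (GRing.isSemilinear.Build _ _ _ _ f fl)).
exists g => v; [apply: (mc_inj hP)|apply: (mc_inj hQ)] => x j /=.
  by rewrite gE fE.
by rewrite fE gE.
Qed.

Lemma has_coords_iso M M' (X : finType) (lab : X -> C) :
  semimod_iso M M' -> has_coords M lab -> has_coords M' lab.
Proof.
move=> /semimod_iso_sym[f [g fK gK]] [P hP]; exists (fun v => P (f v)).
split=> [u v uv|v x j|A /(mc_onto hP)[v vA]|u v x j|s v x j].
- by apply: (can_inj fK); apply: (mc_inj hP).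
- exact: (mc_lab hP).
- by exists (g v) => x j; rewrite gK vA.
- by rewrite raddfD (mc_add hP).
- by rewrite linearZ (mc_scale hP).
Qed.

Lemma has_coords_relabel M (X X' : finType) (lab : X -> C) (lab' : X' -> C)
    (t : X' -> X) :
  bijective t -> (forall x, lab (t x) = lab' x) ->
  has_coords M lab -> has_coords M lab'.
Proof.
move=> [t' tK t'K] tlab [P hP]; exists (fun v x => P v (t x)).
split=> [u v uv|v x j|A Al|u v x j|s v x j].
- by apply: (mc_inj hP) => x j; rewrite -(t'K x).
- by rewrite -tlab; apply: (mc_lab hP).
- have [x j|v vA] := mc_onto hP (A := fun x => A (t' x)).
    by move/Al => <-; rewrite -tlab t'K.
  by exists v => x j; rewrite vA tK.
- exact: (mc_add hP).
- exact: (mc_scale hP).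
Qed.

Lemma has_coords_prod M M' (X X' : finType) (lab : X -> C) (lab' : X' -> C) :
  has_coords M lab -> has_coords M' lab' ->
  has_coords (M * M')%type
    (fun y : X + X' => match y with inl x => lab x | inr x => lab' x end).
Proof.
move=> [P hP] [Q hQ].
exists (fun v y => match y with inl x => P v.1 x | inr x => Q v.2 x end).
split=> [[u u'] [v v'] uv|v [] x j|A Al|u v [] x j|s v [] x j] /=.
- congr (_, _); [apply: (mc_inj hP) => x j; exact: (uv (inl x))|].
  by apply: (mc_inj hQ) => x j; exact: (uv (inr x)).
- exact: (mc_lab hP).
- exact: (mc_lab hQ).
- have [x j|v vA] := mc_onto hP (A := fun x => A (inl x)).
    exact: (Al (inl x)).
  have [x j|v' v'A] := mc_onto hQ (A := fun x => A (inr x)).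
    exact: (Al (inr x)).
  by exists (v, v') => -[].
- exact: (mc_add hP).
- exact: (mc_add hQ).
- exact: (mc_scale hP).
- exact: (mc_scale hQ).
Qed.

Lemma mult_sum (X X' : finType) (lab : X -> C) (lab' : X' -> C) :
  mult (fun y : X + X' => match y with inl x => lab x | inr x => lab' x end) =
  mult lab + mult lab'.
Proof.
apply/ffunP => c; rewrite !ffunE -!sum1_card.
rewrite !(eq_bigl _ _ (fun _ => finset.in_set _ _)).
by rewrite big_sumType /=.
Qed.

Lemma unit_matrix i : exists s, forall j k, phi s j k = (j == i) && (k == i).
Proof. by apply: (bc_onto Sphi) => j k /andP[/eqP-> /eqP->]. Qed.

(* The elements fixed by the j-th diagonal matrix unit correspond to the sets of
   coordinates with label [cl j], so M has 2 ^ mult lab (cl j) of them. *)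
Lemma mult_leq M (X X' : finType) (lab : X -> C) (lab' : X' -> C) c :
  has_coords M lab -> has_coords M lab' -> (mult lab c <= mult lab' c)%N.
Proof.
move=> [P hP] [Q hQ]; have [j jc] := bc_surj Sphi c; rewrite !ffunE.
have [e eE] := unit_matrix j.
(* Acting by [e] keeps column [j] only, so being fixed means being supported in that column, in any
   coordinate system. *)
have fixP (Y : finType) (l : Y -> C) (R : M -> Y -> I -> bool) (v : M) :
    mod_coords l R -> (e : S^c) *: v = v <-> forall x k, R v x k -> k = j.
  move=> hR; have R_e x k : R ((e : S^c) *: v) x k = R v x j && (k == j).
    rewrite (mc_scale hR); apply/existsP/andP => [[i]|[vxj kj]].
      by rewrite eE => /and3P[vi /eqP ij kj]; split=> //; rewrite -ij.
    by exists j; rewrite eE eqxx vxj kj.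
  split=> [<- x k|h]; first by rewrite R_e => /andP[_ /eqP].
  apply: (mc_inj hR) => x k; rewrite R_e.
  apply/andP/idP => [[vxj /eqP->//]|vxk]; have kj := h _ _ vxk.
  by rewrite -kj eqxx.
(* [g A] has the indicator of [A], cut down to label [c], as its column [j]. It is fixed by [e], so
   its [Q] coordinates also lie in column [j], where [h] reads them off. *)
have g_ex (A : {set X}) : exists v, forall x k,
    P v x k = [&& x \in A, lab x == c & k == j].
  by apply: (mc_onto hP) => x k /and3P[_ /eqP-> /eqP->].
have [g gE] := choice g_ex.
have gfix A x k : Q (g A) x k -> k = j.
  move: x k; apply/(fixP _ _ _ _ hQ)/(fixP _ _ _ _ hP) => x k.
  by rewrite gE => /and3P[_ _ /eqP].
pose h A := [set x | Q (g A) x j]%SET.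
set F := [set x | lab x == c]%SET; set F' := [set x | lab' x == c]%SET.
have h_inj : {in powerset F &, injective h}.
  move=> A B; rewrite !inE => /fintype.subsetP AF /fintype.subsetP BF hAB.
  have gAB : g A = g B.
    apply: (mc_inj hQ) => x k; have [->|kj] := eqVneq k j.
      by move/finset.setP/(_ x): hAB; rewrite !inE.
    by apply/idP/idP => /gfix/eqP; rewrite (negPf kj).
  apply/finset.setP => x; have := gE A x j; rewrite gAB gE eqxx !andbT.
  have := AF x; have := BF x; rewrite !inE.
  case: (x \in A); case: (x \in B) => //=.
    by move=> _ /(_ isT)->.
  by move=> /(_ isT)->.
have hF : h @: powerset F \subset powerset F'.
  apply/fintype.subsetP => _ /imsetP[A _ ->]; rewrite inE.
  apply/fintype.subsetP => x; rewrite !inE => /(mc_lab hQ)->; by rewrite jc.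
have := subset_leq_card hF; rewrite card_in_imset // !card_powerset.
by rewrite leq_exp2l.
Qed.

Lemma mult_uniq M (X X' : finType) (lab : X -> C) (lab' : X' -> C) :
  has_coords M lab -> has_coords M lab' -> mult lab = mult lab'.
Proof.
move=> h h'; apply/ffunP => c; apply/eqP; rewrite eqn_leq.
by rewrite (mult_leq c h h') (mult_leq c h' h).
Qed.

Lemma mult_iso M M' (X X' : finType) (lab : X -> C) (lab' : X' -> C) :
  has_coords M lab -> has_coords M' lab' -> mult lab = mult lab' ->
  semimod_iso M M'.
Proof.
move=> h h' /mult_bij[t tbij tlab].
exact: coords_iso h (has_coords_relabel tbij tlab h').
Qed.

Lemma regular_coords : has_coords (right_regular S) cl.
Proof.
exists phi; split=> [u v|s i j|A|u v i j|s v i j].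
- exact: (bc_inj Sphi).
- exact: (bc_cl Sphi).
- exact: (bc_onto Sphi).
- exact: (bc_add Sphi).
- exact: (bc_mul Sphi).
Qed.

Lemma bc_zero i j : phi (0 : S) i j = false.
Proof.
have [|s sE] := bc_onto Sphi (A := fun _ _ => false) => //.
by have := bc_add Sphi 0 s i j; rewrite add0r sE; case: phi.
Qed.

Lemma bc_sum (K : finType) (Q : pred K) (F : K -> S) i j :
  phi (\sum_(k | Q k) F k) i j = [exists k, Q k && phi (F k) i j].
Proof.
rewrite -big_orE; elim/big_rec2: _ => [|k b s Qk <-]; first exact: bc_zero.
exact: (bc_add Sphi).
Qed.

(** The vectors [b x] are the diagonal matrix units placed in one position of the row. Each lies in
    the summand or in its complement, the summand is spanned by those it contains, and these index
    its coordinates. *)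
Lemma summand_coords (D : free_summand S^c) :
  exists (X : finType) (lab : X -> C), has_coords (fs_semimod D) lab.
Proof.
case: D => n P [Q PQ] /=.
have [E EE] := choice unit_matrix.
pose b (x : 'I_n * I) : 'rV[S^c]_n :=
  \row_a (if a == x.1 then E x.2 else 0 : S).
have phib x a i j : phi (b x 0 a) i j = [&& a == x.1, i == x.2 & j == x.2].
  by rewrite mxE; case: eqVneq => _; rewrite ?EE ?bc_zero.
have rv_inj (u v : 'rV[S^c]_n) :
    (forall a i j, phi (u 0 a) i j = phi (v 0 a) i j) -> u = v.
  by move=> uv; apply/rowP => a; apply: (bc_inj Sphi).
have rv_add (u v : 'rV[S^c]_n) a i j :
    phi ((u + v) 0 a) i j = phi (u 0 a) i j || phi (v 0 a) i j.
  by rewrite mxE (bc_add Sphi).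
have rv_scale (s : S) (v : 'rV[S^c]_n) a i k :
    phi (((s : S^c) *: v) 0 a) i k = [exists j, phi (v 0 a) i j && phi s j k].
  by rewrite mxE (bc_mul Sphi).
have rv_zero a i j : phi ((0 : 'rV[S^c]_n) 0 a) i j = false.
  by rewrite mxE bc_zero.
have bPQ x : b x \in P \/ b x \in Q.
  have [[p q] [[/= pP qQ bE] _]] := PQ (b x).
  have pq a i j : phi (p 0 a) i j || phi (q 0 a) i j =
      [&& a == x.1, i == x.2 & j == x.2].
    by rewrite -rv_add -bE phib.
  (* [b x] has a single true entry, so whichever of [p] and [q] carries that entry equals [b x]. *)
  have [px|px] := boolP (phi (p 0 x.1) x.2 x.2); [left|right].
    suff -> : b x = p by [].
    apply: rv_inj => a i j; rewrite phib; have := pq a i j.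
    case: and3P => [[/eqP-> /eqP-> /eqP->]|_]; first by rewrite px.
    by case: phi.
  suff -> : b x = q by [].
  apply: rv_inj => a i j; rewrite phib; have := pq a i j.
  case: and3P => [[/eqP-> /eqP-> /eqP->]|_]; first by rewrite (negPf px).
  by case: phi => //; rewrite ?orbT //; case: phi.
have expand (v : 'rV[S^c]_n) : v = \sum_x ((v 0 x.1) : S^c) *: b x.
  apply: rv_inj => a i j; rewrite summxE bc_sum.
  apply/idP/existsP => [vij|[x /=]].
    exists (a, i) => /=; rewrite rv_scale; apply/existsP; exists i.
    by rewrite phib !eqxx.
  rewrite rv_scale => /existsP[k]; rewrite phib.
  move=> /andP[/and3P[/eqP-> /eqP-> /eqP->]].
  by [].
have memP v : v \in P <-> forall x, b x \notin P -> (v 0 x.1 : S^c) *: b x = 0.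
  split=> [vP x xP|h]; last first.
    rewrite [v]expand; apply: rpred_sum => x _.
    by have [/rpredZ//|/h->] := boolP (b x \in P); exact: rpred0.
  have [p [_ pU]] := PQ v.
  (* For [v] in [P], compare the decomposition [v + 0] with the splitting of the expansion of [v]
     according to membership of [b x] in [P]. The part in [Q] is then 0, and a vanishing Boolean sum
     has vanishing terms. *)
  have pE1 : p = (v, 0) by apply: pU; split; rewrite ?rpred0 ?addr0.
  pose u := (\sum_(x | b x \in P) (v 0 x.1 : S^c) *: b x,
             \sum_(x | b x \notin P) (v 0 x.1 : S^c) *: b x).
  have pu : p = u.
    apply: pU; split=> /=.
    - by apply: rpred_sum => y yP; exact: rpredZ.
    - apply: rpred_sum => y yP; apply: rpredZ.
      by case: (bPQ y) yP => // ->.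
    - by rewrite {1}[v]expand (bigID (fun x => b x \in P)).
  move: pu; rewrite pE1 => /(congr1 snd)/esym/=; rewrite (bigD1 x) //= => s0.
  apply: rv_inj => a i j.
  have /(congr1 (fun u : 'rV_n => phi (u 0 a) i j)) := s0.
  by rewrite rv_add !rv_zero; case: phi.
pose X : finType := {x : 'I_n * I | b x \in P}.
exists X, (fun x => cl (val x).2).
exists (fun (v : subsemimod P) (x : X) j =>
  phi (val v 0 (val x).1) (val x).2 j).
(* Dropping the positions outside [X] loses nothing: elements of [P] have no true entry there. *)
have outP v x : v \in P -> b x \notin P ->
    forall j, phi (v 0 x.1) x.2 j = false.
  move=> /memP h /h v0 j.
  have /(congr1 (fun u : 'rV_n => phi (u 0 x.1) x.2 j)) := v0.
  rewrite rv_scale rv_zero => <-; apply/idP/existsP => [vj|[k]].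
    by exists x.2; rewrite phib !eqxx.
  by rewrite phib => /andP[/and3P[_ _ /eqP->]].
split=> [u v uv|v x j|A Al|u v x j|s v x j].
- apply: val_inj; apply: rv_inj => a i j.
  have [xP|xP] := boolP (b (a, i) \in P); first exact: (uv (exist _ (a, i) xP)).
  by rewrite !(outP _ (a, i)) ?(valP u) ?(valP v).
- exact: (bc_cl Sphi).
(* Extend [A] by [false] to the positions whose basis vector is not in [P]. *)
- pose B a i j := if insub (a, i) is Some x then A x j else false.
  have [|v vE] := choice (fun a => bc_onto Sphi (A := B a) _).
    move=> a i j; rewrite /B; case: insubP => // x _ xE Axj.
    by rewrite -(Al x j Axj) [val x]xE.
  have vP : \row_a (v a : S^c) \in P.
    apply/memP => x xP; apply: rv_inj => a i j.
    rewrite rv_scale rv_zero; apply/existsP => -[k].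
    rewrite phib mxE vE => /andP[/and3P[_ _ /eqP->]]; by rewrite /B insubN.
  exists (exist (fun w => w \in P) _ vP : subsemimod P) => x j /=.
  by rewrite mxE vE /B -surjective_pairing valK.
- exact: rv_add.
- exact: rv_scale.
Qed.

(** For complementary orthogonal idempotents [e] and [f], being killed by [f] describes the right
    ideal generated by [e] through a Boolean equation. *)
Definition row_killed (e : S) : {pred 'rV[S^c]_1} :=
  [pred v : 'rV[S^c]_1 | e * (v 0 0 : S) == 0].

Fact row_killed_closed e : GRing.subsemimod_closed (row_killed e).
Proof.
split=> [|a v]; last first.
  rewrite !inE mxE => /eqP h.
  by rewrite -[a * _]/((v 0 0 : S) * a) mulrA h mul0r.
split=> [|u v]; first by rewrite inE mxE mulr0.
by rewrite !inE mxE mulrDr => /eqP-> /eqP->; rewrite addr0.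
Qed.

HB.instance Definition _ e := GRing.isSubSemiModClosed.Build S^c 'rV[S^c]_1
  (row_killed e) (row_killed_closed e).

Definition row_killed_sub e : submodClosed 'rV[S^c]_1 :=
  row_killed e : submodClosed _.

Lemma row_killed_summand (e f : S) : e + f = 1 -> e * f = 0 -> f * e = 0 ->
  direct_summand (row_killed_sub f).
Proof.
move=> ef1 ef fe; exists (row_killed_sub e) => v.
have ee : e * e = e by rewrite -[RHS]mulr1 -ef1 mulrDr ef addr0.
have ff : f * f = f by rewrite -[RHS]mulr1 -ef1 mulrDr fe add0r.
exists (\row__ (e * (v 0 0 : S) : S^c), \row__ (f * (v 0 0 : S) : S^c)); split.
  split; rewrite ?inE ?mxE ?mulrA ?ef ?fe ?mul0r //.
  apply/rowP => a; rewrite !mxE ord1.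
  by rewrite -[RHS]/(e * (v 0 0 : S) + f * (v 0 0 : S)) -mulrDl ef1 mul1r.
case=> p q [/= /eqP pP /eqP qQ ->].
congr (_, _); apply/rowP => a; rewrite !mxE ord1.
  rewrite -[LHS]/(e * ((p 0 0 : S) + (q 0 0 : S))).
  by rewrite mulrDr qQ addr0 -[RHS](@mul1r S) -ef1 mulrDl pP addr0.
rewrite -[LHS]/(f * ((p 0 0 : S) + (q 0 0 : S))).
by rewrite mulrDr pP add0r -[RHS](@mul1r S) -ef1 mulrDl qQ add0r.
Qed.

(** Here [e] is the [i]-th diagonal matrix unit and [f] the rest of the identity. Elements killed by
    [f] are the matrices supported in row [i], which leaves one row of coordinates, labelled [cl i].
    These summands realize the basis vectors of the monoid of multiplicities. *)
Lemma column_summand i : exists D : free_summand S^c,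
  has_coords (fs_semimod D) (fun _ : unit => cl i).
Proof.
have [e eE] := unit_matrix i.
have [|f fE] := bc_onto Sphi (A := fun j k => (j == k) && (j != i)).
  by move=> j k /andP[/eqP->].
have ef1 : e + f = 1.
  apply: (bc_inj Sphi) => j k; rewrite (bc_add Sphi) (bc_one Sphi) eE fE.
  by have [->|] := eqVneq j i; rewrite /= ?andbT ?andbF ?orbF.
have ef : e * f = 0.
  apply: (bc_inj Sphi) => j k; rewrite bc_zero (bc_mul Sphi).
  apply/existsP => -[l].
  by rewrite eE fE => /andP[/andP[_ ->] /andP[_]].
have fe : f * e = 0.
  apply: (bc_inj Sphi) => j k; rewrite bc_zero (bc_mul Sphi).
  apply/existsP => -[l].
  by rewrite eE fE => /andP[/andP[/eqP-> /negPf->]].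
exists (FreeSummand (row_killed_summand ef1 ef fe)).
exists (fun (v : subsemimod (row_killed_sub f)) _ j => phi (val v 0 0) i j).
have killed (s : S) : f * s = 0 <-> forall j k, phi s j k -> j = i.
  split=> [fs j k sjk|h].
    apply: contrapT => /eqP ji; have := bc_zero j k; rewrite -fs (bc_mul Sphi).
    by move/existsP; apply; exists j; rewrite fE eqxx ji.
  apply: (bc_inj Sphi) => j k; rewrite bc_zero (bc_mul Sphi).
  apply/existsP => -[l].
  by rewrite fE => /andP[/andP[/eqP <- ji] /h]; apply/eqP.
split=> [u v uv|v x j|A Al|u v x j|s v x j].
- apply: val_inj; apply/rowP => a; rewrite ord1; apply: (bc_inj Sphi) => j k.
  have [->|ji] := eqVneq j i; first exact: uv tt k.
  have /eqP/killed uP := valP u; have /eqP/killed vP := valP v.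
  by apply/idP/idP => [/uP|/vP] /eqP; rewrite (negPf ji).
- exact: (bc_cl Sphi).
- have [|s sE] := bc_onto Sphi (A := fun j k => (j == i) && A tt k).
    by move=> j k /andP[/eqP-> /Al].
  have sP : \row_(_ < 1) (s : S^c) \in row_killed_sub f.
    by rewrite inE mxE; apply/eqP/killed => j k; rewrite sE => /andP[/eqP].
  exists (exist (fun w => w \in row_killed_sub f) _ sP
    : subsemimod (row_killed_sub f)) => -[] j.
  by rewrite /= mxE sE eqxx.
- by rewrite /= mxE (bc_add Sphi).
- by rewrite /= mxE (bc_mul Sphi).
Qed.

End ModuleCoords.

(** * Isomorphisms between free commutative monoids of finite rank *)

Lemma inj_surj_bij (A B : Type) (f : A -> B) :
  injective f -> (forall y, exists x, f x = y) -> bijective f.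
Proof. by move=> finj /choice[g gK]; exists g => // x; apply: finj. Qed.

Lemma ffun_nat_addIr (C : finType) (k m n : {ffun C -> nat}) :
  m + k = n + k -> m = n.
Proof.
move=> /ffunP mn; apply/ffunP => c; apply: (@addIn (k c)).
by have := mn c; rewrite !ffunE.
Qed.

(** Preservation of 0 comes from cancelling [f 0] in [f 0 + f 0 = f 0]. *)
Lemma additive_ffun_nat (V : nmodType) (C : finType)
    (f : V -> {ffun C -> nat}) :
  {morph f : x y / x + y} -> nmod_morphism f.
Proof.
move=> fD; split=> //; apply: (@ffun_nat_addIr _ (f 0)).
by rewrite -fD !add0r.
Qed.

Definition delta (C : finType) (c : C) : {ffun C -> nat} :=
  [ffun d => (d == c) : nat].

Lemma ffun_nat_expand (C : finType) (n : {ffun C -> nat}) :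
  n = \sum_c delta c *+ n c.
Proof.
apply/ffunP => d; rewrite sum_ffunE (bigD1 d) //= big1 => [|c cd].
  by rewrite addr0 ffunMnE ffunE eqxx natn.
by rewrite ffunMnE ffunE eq_sym (negPf cd) mul0rn.
Qed.

Section FfunNatIso.

Lemma delta_inj (C : finType) : injective (@delta C).
Proof. by move=> c d /ffunP/(_ c); rewrite !ffunE eqxx; case: eqVneq. Qed.

Let irreducible (C : finType) (m : {ffun C -> nat}) :=
  m <> 0 /\ forall a b, m = a + b -> a = 0 \/ b = 0.

(** A nonzero [m] splits off [delta c] for any [c] in its support. Conversely, the single unit of
    [delta c] falls into one of two summands, and the other is 0. *)
Let irreducible_delta (C : finType) (m : {ffun C -> nat}) :
  irreducible m <-> exists c, m = delta c.
Proof.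
have delta_neq0 c : @delta C c <> 0.
  by move/ffunP/(_ c); rewrite !ffunE eqxx.
split=> [[m0 mirr]|[c ->]].
  have [c mc] : exists c, m c <> 0%N.
    apply: contrapT => no; apply: m0; apply/ffunP => c; rewrite ffunE.
    by apply: contrapT => mc; apply: no; exists c.
  pose r : {ffun C -> nat} := [ffun d => (m d - (d == c))%N].
  have mE : m = delta c + r.
    apply/ffunP => d; rewrite !ffunE; apply/esym/subnKC.
    by have [->|//] := eqVneq; rewrite lt0n; apply/eqP.
  by case: (mirr _ _ mE) => [/delta_neq0//|r0]; exists c; rewrite mE r0 addr0.
split=> // a b /ffunP ab.
have ab0 d : d != c -> a d = 0%N /\ b d = 0%N.
  by move=> dc; have := ab d; rewrite !ffunE (negPf dc);
    case: (a d); case: (b d).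
have := ab c; rewrite !ffunE eqxx.
case ac: (a c) => [|k] bc; [left|right]; apply/ffunP => d; rewrite ffunE;
  have [->//|/ab0[]//] := eqVneq d c.
by case: k bc {ac} => // [] [].
Qed.

(** [H] and its inverse preserve irreducible elements, so they restrict to mutually inverse
    bijections between the vectors [delta c]; additivity then determines [H]. *)
Lemma ffun_nat_iso (C C' : finType)
    (H : {additive {ffun C -> nat} -> {ffun C' -> nat}}) :
  bijective H ->
  exists2 s : C -> C', bijective s & forall n c, H n (s c) = n c.
Proof.
move=> [G HK GK].
have GD : {morph G : x y / x + y}.
  by move=> x y; apply: (can_inj HK); rewrite GK raddfD !GK.
have G0 : G 0 = 0 by apply: (can_inj HK); rewrite GK raddf0.
have s_ex c : exists c', H (delta c) = delta c'.
  have [d0 dirr] := (irreducible_delta (delta c)).2 (ex_intro _ c erefl).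
  apply/irreducible_delta; split=> [H0|a b Hab].
    by apply: d0; apply: (can_inj HK); rewrite H0 raddf0.
  have /dirr[h|h] : delta c = G a + G b by rewrite -GD -Hab HK.
    by left; rewrite -[a]GK h raddf0.
  by right; rewrite -[b]GK h raddf0.
have s'_ex c' : exists c, G (delta c') = delta c.
  have [d0 dirr] := (irreducible_delta (delta c')).2 (ex_intro _ c' erefl).
  apply/irreducible_delta; split=> [H0|a b Gab].
    by apply: d0; rewrite -[LHS]GK H0 raddf0.
  have /dirr[h|h] : delta c' = H a + H b by rewrite -raddfD -Gab GK.
    by left; rewrite -[a]HK h G0.
  by right; rewrite -[b]HK h G0.
have [s sE] := choice s_ex; have [s' s'E] := choice s'_ex.
have sK : cancel s s' by move=> c; apply: delta_inj; rewrite -s'E -sE HK.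
have s'K : cancel s' s by move=> c; apply: delta_inj; rewrite -sE -s'E GK.
exists s => [|n c]; first by exists s'.
rewrite {1}[n]ffun_nat_expand raddf_sum sum_ffunE (bigD1 c) //= big1 => [|d dc].
  by rewrite addr0 raddfMn sE ffunMnE ffunE eqxx natn.
by rewrite raddfMn sE ffunMnE ffunE (can_eq sK) eq_sym (negPf dc) mul0rn.
Qed.

End FfunNatIso.

(** * The monoid of isomorphism classes *)

Section IsoclassMult.
Variables (S : pzSemiRingType) (I C : finType) (cl : I -> C)
  (phi : S -> I -> I -> bool) (Sphi : bool_coords cl phi).

(** The multiplicity vector is well defined by [mult_uniq], injective by [mult_iso], additive by
    [mult_sum], and surjective because [column_summand] attains every [delta c]. *)
Lemma isoclass_mult :
  exists mu : {additive isoclass S^c -> {ffun C -> nat}},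
    bijective mu /\ mu (iso_class (fgsp_right_regular S)) = mult cl.
Proof.
have mu_ex (x : isoclass S^c) : exists m : {ffun C -> nat},
    forall (X : finType) (lab : X -> C),
      has_coords cl phi (fs_semimod (repr x)) lab -> m = mult lab.
  have [X [lab h]] := summand_coords Sphi (repr x).
  by exists (mult lab) => X' lab'; exact: mult_uniq h.
have [mu muE] := choice mu_ex.
have mu_class M (pM : fg_strongly_projective M) (X : finType) (lab : X -> C) :
    has_coords cl phi M lab -> mu (iso_class pM) = mult lab.
  move=> h; apply: muE; apply: has_coords_iso h.
  apply/(iso_classP pM (fgsp_summand _)); symmetry; exact: iso_class_repr.
have coords_ex (x : isoclass S^c) : exists (M : lSemiModType S^c)
    (pM : fg_strongly_projective M) (X : finType) (lab : X -> C),
    x = iso_class pM /\ has_coords cl phi M lab.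
  have [X [lab h]] := summand_coords Sphi (repr x).
  exists (fs_semimod (repr x)), (fgsp_summand (repr x)), X, lab.
  by rewrite iso_class_repr.
have muD : {morph mu : x y / x + y}.
  move=> x y; have [M [pM [X [lab [-> h]]]]] := coords_ex x.
  have [M' [pM' [X' [lab' [-> h']]]]] := coords_ex y.
  rewrite [iso_class pM + _]isoclass_addE.
  rewrite (mu_class _ _ _ _ (has_coords_prod h h')).
  by rewrite mult_sum (mu_class _ _ _ _ h) (mu_class _ _ _ _ h').
pose f : {additive isoclass S^c -> {ffun C -> nat}} :=
  HB.pack_for {additive isoclass S^c -> {ffun C -> nat}} mu
    (GRing.isNmodMorphism.Build _ _ mu (additive_ffun_nat muD)).
exists f; split; last by apply: mu_class; exact: regular_coords.
apply: inj_surj_bij => [x y|n].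
  have [M [pM [X [lab [-> h]]]]] := coords_ex x.
  have [M' [pM' [X' [lab' [-> h']]]]] := coords_ex y.
  rewrite /f /= (mu_class _ _ _ _ h) (mu_class _ _ _ _ h') => e.
  by apply/iso_classP; exact: mult_iso h h' e.
have x_ex c : exists x : isoclass S^c, f x = delta c.
  have [i ic] := bc_surj Sphi c.
  have [D hD] := column_summand Sphi i.
  exists (iso_class (fgsp_summand D)); rewrite /f /= (mu_class _ _ _ _ hD).
  apply/ffunP => d; rewrite !ffunE ic.
  case: eqVneq => _; first by rewrite cardsE card_unit.
  by apply: eq_card0 => u; rewrite inE.
have [x xE] := choice x_ex.
exists (\sum_c x c *+ n c); rewrite raddf_sum [RHS]ffun_nat_expand.
by apply: eq_bigr => c _; rewrite raddfMn xE.
Qed.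

End IsoclassMult.

(** * Passing between the monoid of classes and its ordered group completion *)

Section GrothMap.
Variables (V W : nmodType) (h : {additive V -> W}).

Definition groth_map (x : groth V) : groth W :=
  groth_pi (h (repr x).1, h (repr x).2).

Lemma groth_map_pi x : groth_map (groth_pi x) = groth_pi (h x.1, h x.2).
Proof.
have /groth_piP[k e] := groth_pi_repr (groth_pi x).
by apply/groth_piP; exists (h k); rewrite /= -!raddfD e.
Qed.

Lemma groth_map_class a : groth_map (groth_class a) = groth_class (h a).
Proof. by rewrite [LHS]groth_map_pi raddf0. Qed.

Fact groth_map_nmod_morphism : nmod_morphism groth_map.
Proof.
split=> [|x y]; first by rewrite -[0]/(groth_class 0) groth_map_class raddf0.
rewrite -(groth_pi_repr x) -(groth_pi_repr y) [_ + _]groth_addE !groth_map_pi.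
by rewrite [RHS]groth_addE /= !raddfD.
Qed.

HB.instance Definition _ :=
  GRing.isNmodMorphism.Build (groth V) (groth W) groth_map
    groth_map_nmod_morphism.

End GrothMap.

Lemma additive_inverse (V W : nmodType) (h : {additive V -> W}) : bijective h ->
  exists g : {additive W -> V}, cancel h g /\ cancel g h.
Proof.
move=> [g hK gK]; have gD : nmod_morphism g.
  split=> [|x y]; apply: (can_inj hK); rewrite gK ?raddf0 //.
  by rewrite raddfD !gK.
by exists (HB.pack_for {additive W -> V} g
  (GRing.isNmodMorphism.Build _ _ g gD)).
Qed.

Lemma groth_map_bij (V W : nmodType) (h : {additive V -> W}) :
  bijective h -> bijective (groth_map h).
Proof.
move=> /additive_inverse[g [hK gK]]; exists (groth_map g) => x;
  by rewrite -(groth_pi_repr x) !groth_map_pi /= ?hK ?gK -surjective_pairing.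
Qed.

Lemma SK0_posE (S : pzSemiRingType) (x : SK0 S) :
  SK0_pos S x <-> exists a, x = groth_class a.
Proof.
split=> [[P [pP ->]]|[a ->]]; first by exists (iso_class pP).
by have [M [pM ->]] := iso_class_surj a; exists M, pM.
Qed.

Lemma isoclass_iso_SK0 (S T : pzSemiRingType)
    (h : {additive isoclass S^c -> isoclass T^c}) : bijective h ->
  h (iso_class (fgsp_right_regular S)) = iso_class (fgsp_right_regular T) ->
  SK0_iso S T.
Proof.
move=> hbij h1; exists (groth_map h : {additive groth _ -> groth _}).
split; first exact: groth_map_bij.
  by rewrite /SK0_unit /SK0_class /= groth_map_class h1.
apply/seteqP.
split=> [_ [x /SK0_posE[a ->] <-]|y /SK0_posE[b ->]].
  by apply/SK0_posE; exists (h a); rewrite /= groth_map_class.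
have [g hK gK] := hbij; exists (groth_class (g b)).
  by apply/SK0_posE; exists (g b).
by rewrite /= groth_map_class gK.
Qed.

(** Cancellativity makes [groth_class] injective, so the positive cone is a copy of the monoid of
    classes; [f] maps one cone onto the other and so restricts to the monoids. *)
Lemma SK0_isoclass_iso (S T : pzSemiRingType) :
  (forall k x y : isoclass S^c, x + k = y + k -> x = y) ->
  (forall k x y : isoclass T^c, x + k = y + k -> x = y) ->
  SK0_iso S T ->
  exists h : {additive isoclass S^c -> isoclass T^c}, bijective h /\
    h (iso_class (fgsp_right_regular S)) = iso_class (fgsp_right_regular T).
Proof.
move=> cS cT [f [fbij f1 fpos]].
have injS (a b : isoclass S^c) : groth_class a = groth_class b -> a = b.
  by case/groth_class_eq => k; exact: cS.
have injT (a b : isoclass T^c) : groth_class a = groth_class b -> a = b.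
  by case/groth_class_eq => k; exact: cT.
have h_ex (a : isoclass S^c) : exists b : isoclass T^c,
    f (groth_class a) = groth_class b.
  apply/SK0_posE; rewrite -fpos; exists (groth_class a) => //.
  by apply/SK0_posE; exists a.
have [h hE] := choice h_ex.
have hm : nmod_morphism h.
  split=> [|x y]; apply: injT; rewrite -hE; first by rewrite !raddf0.
  by rewrite !raddfD !hE.
exists (HB.pack_for {additive isoclass S^c -> isoclass T^c} h
  (GRing.isNmodMorphism.Build _ _ h hm)); split=> /=; last first.
  by apply: injT; rewrite -hE.
apply: inj_surj_bij => [x y hxy|b].
  by apply: injS; apply: (bij_inj fbij); rewrite !hE hxy.
have : SK0_pos T (groth_class b) by apply/SK0_posE; exists b.
rewrite -fpos => -[_ /SK0_posE[a ->]] fab; exists a.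
by apply: injT; rewrite -hE.
Qed.

(** * Transport of coordinates and the classification *)

Lemma bool_coords_iso (S T : pzSemiRingType) (I C : finType) (cl : I -> C)
    (phi : S -> I -> I -> bool) (g : S -> T) (g' : T -> S) :
  {morph g : x y / x + y} -> GRing.monoid_morphism g -> cancel g g' ->
  cancel g' g -> bool_coords cl phi ->
  bool_coords cl (fun t => phi (g' t)).
Proof.
move=> gD [g1 gM] gK g'K h.
split=> [c|s t st|s i j|A /(bc_onto h)[s sA]|s t i j|s t i k|i j].
- exact: (bc_surj h).
- by apply: (can_inj g'K); apply: (bc_inj h).
- exact: (bc_cl h).
- by exists (g s) => i j; rewrite gK.
- by rewrite -(bc_add h); congr phi; apply: (can_inj gK); rewrite gD !g'K.
- by rewrite -(bc_mul h); congr phi; apply: (can_inj gK); rewrite gM !g'K.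
- by rewrite -(bc_one h); congr phi; apply: (can_inj gK); rewrite g1 !g'K.
Qed.

(** Reindexing matrices along [t] respects the block support in both directions, since [s] is
    injective and intertwines the labels. *)
Lemma bool_coords_matching (S T : pzSemiRingType) (I C I' C' : finType)
    (cl : I -> C) (cl' : I' -> C') (phi : S -> I -> I -> bool)
    (phi' : T -> I' -> I' -> bool) (t : I -> I') (s : C -> C') :
  bool_coords cl phi -> bool_coords cl' phi' ->
  bijective t -> injective s -> (forall i, cl' (t i) = s (cl i)) ->
  exists g : S -> T,
    [/\ nmod_morphism g, GRing.monoid_morphism g & bijective g].
Proof.
move=> hS hT [t' tK t'K] sinj tcl.
have t'cl i j : cl (t' i) = cl (t' j) <-> cl' i = cl' j.
  rewrite -{2}(t'K i) -{2}(t'K j) !tcl; split=> [->//|]; exact: sinj.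
have g_ex x : exists y, forall i j, phi' y i j = phi x (t' i) (t' j).
  by apply: (bc_onto hT) => i j /(bc_cl hS)/t'cl.
have [g gE] := choice g_ex.
have gD : nmod_morphism g.
  split=> [|x y]; apply: (bc_inj hT) => i j.
    by rewrite gE (bc_zero hS) (bc_zero hT).
  by rewrite gE (bc_add hS) (bc_add hT) !gE.
have gM : GRing.monoid_morphism g.
  split=> [|x y]; apply: (bc_inj hT) => i j.
    by rewrite gE (bc_one hS) (bc_one hT) (can_eq t'K).
  rewrite gE (bc_mul hS) (bc_mul hT); apply/existsP/existsP => -[k].
    by exists (t k); rewrite !gE tK.
  by rewrite !gE; exists (t' k).
exists g; split=> //.
apply: inj_surj_bij => [x y /= gxy|y].
  by apply: (bc_inj hS) => i j; rewrite -(tK i) -(tK j) -!gE gxy.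
have [|x xE] := bc_onto hS (A := fun i j => phi' y (t i) (t j)).
  by move=> i j /(bc_cl hT); rewrite !tcl => /sinj.
by exists x; apply: (bc_inj hT) => i j; rewrite /= gE xE !t'K.
Qed.

Lemma Balgebra_iso_intro (S T : pzSemiRingType) (idS : forall s : S, s + s = s)
    (idT : forall t : T, t + t = t) (g : S -> T) :
  nmod_morphism g -> GRing.monoid_morphism g -> bijective g ->
  Balgebra_iso idS idT.
Proof.
move=> gD gM gbij; pose A : pzSemiRingType := Balgebra idS.
pose B : pzSemiRingType := Balgebra idT; pose g' : A -> B := g.
have g'D : nmod_morphism g' := gD.
have g'M : GRing.monoid_morphism g' := gM.
pose G : {rmorphism A -> B} := HB.pack_for {rmorphism A -> B} g'
  (GRing.isNmodMorphism.Build A B g' g'D)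
  (GRing.isMonoidMorphism.Build A B g' g'M).
(* A Boolean scalar acts as the identity or as 0, so scalability only needs that 0 is preserved. *)
by exists G; split=> // -[] x //; exact: (rmorph0 G).
Qed.

Theorem theorem6p22 (S T : pzSemiRingType)
    (zS : zerosumfree S) (zT : zerosumfree T)
    (sS : congruence_semisimple S) (sT : congruence_semisimple T) :
  SK0_iso S T <->
  Balgebra_iso (congruence_semisimple_idem zS sS)
               (congruence_semisimple_idem zT sT).
Proof.
have [I [C [cl [phi hS]]]] := semisimple_coords zS sS.
have [mS [mSbij mS1]] := isoclass_mult hS.
have [nS [mSK nSK]] := additive_inverse mSbij.
split=> [ST|[g [_ [g' gK g'K]]]]; last first.
  (* A semiring isomorphism gives T the coordinates of S with the same labelling [cl], so both
     monoids of classes are identified with the same free monoid and the same unit vector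
     [mult cl]. *)
  have hT : bool_coords cl (fun t : T => phi (g' t)).
    exact: (@bool_coords_iso S T _ _ _ _ g g' (rmorphD g)
      (conj (rmorph1 g) (rmorphM g)) gK g'K hS).
  have [mT [mTbij mT1]] := isoclass_mult hT.
  have [nT [mTK nTK]] := additive_inverse mTbij.
  apply: (@isoclass_iso_SK0 _ _ (nT \o mS)).
    by apply: bij_comp => //; exists mT.
  by rewrite /= mS1 -mT1 mTK.
have [I' [C' [cl' [phi' hT]]]] := semisimple_coords zT sT.
have [mT [mTbij mT1]] := isoclass_mult hT.
have cancelS (k x y : isoclass S^c) : x + k = y + k -> x = y.
  move=> /(congr1 mS); rewrite !raddfD => /ffun_nat_addIr; exact: bij_inj.
have cancelT (k x y : isoclass T^c) : x + k = y + k -> x = y.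
  move=> /(congr1 mT); rewrite !raddfD => /ffun_nat_addIr; exact: bij_inj.
have [h [hbij h1]] := SK0_isoclass_iso cancelS cancelT ST.
(* Read through multiplicities, [h] becomes an isomorphism of free monoids, hence a bijection [s] of
   blocks. Preservation of the unit says that [s] preserves block sizes, which lifts it to a
   bijection [t] of the indices. *)
have [|s sbij sE] := @ffun_nat_iso C C' (mT \o (h \o nS)).
  by do 2 apply: bij_comp => //; exists mS.
have sm c : mult cl' (s c) = mult cl c.
  by rewrite -(sE (mult cl)) /= -mS1 mSK h1 mT1.
have [|t tbij tcl] := @mult_bij I I' C' (s \o cl) cl'.
  have [s' sK s'K] := sbij; apply/ffunP => c'; rewrite -(s'K c') sm !ffunE.
  by apply: eq_card => i; rewrite !inE /= (can_eq sK).
have [g [gD gM gbij]] := bool_coords_matching hS hT tbij (bij_inj sbij) tcl.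
exact: Balgebra_iso_intro gD gM gbij.
Qed.
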